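(* Let $m$ be a positive integer. If an integer $k\geq 2$ satisfies $k\equiv 1 \pmod{m!/m\#}$, then $N_k > m$. In particular, $\sup_{k\geq 2}N_k=\infty$.
   Context: For each integer $k\geq 2$, the $k$-Göbel sequence $(g_{k,n})_{n\geq 1}$ is the sequence of rational numbers defined by the initial value $g_{k,1}=2$ and the recursion $n\,g_{k,n}=(n-1)\,g_{k,n-1}+g_{k,n-1}^{\,k}$ for $n\geq 2$. Define $N_k := \inf\{n\geq 1 \mid g_{k,n}\notin\mathbb{Z}\}$, with the usual convention $\inf\emptyset=\infty$ (so $N_k\in\mathbb{Z}_{\geq 1}\cup\{\infty\}$). For a positive integer $m$, $m\#$ denotes the primorial of $m$, i.e. the product of all primes $p\leq m$ (equivalently, the radical of $m!$; in particular $1\#=1$). *)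

(* Defs.v *)
From mathcomp Require Import all_boot all_order all_algebra.
From mathcomp Require Import all_classical all_reals all_analysis.

Set Implicit Arguments.
Unset Strict Implicit.
Unset Printing Implicit Defensive.

Import Order.TTheory GRing.Theory Num.Theory.

Local Open Scope classical_set_scope.
Local Open Scope ring_scope.

(* The value at n = 0 is junk: the sequence is indexed by n >= 1. *)
Fixpoint goebel (k n : nat) : rat :=
  match n with
  | 0 => 0
  | n'.+1 =>
      if n' == 0%N then 2
      else (n'%:R * goebel k n' + goebel k n' ^+ k) / n'.+1%:R
  end.

Lemma goebel1 (k : nat) : goebel k 1 = 2.
Proof. by []. Qed.

Lemma goebel_rec (k n : nat) : (2 <= n)%N ->
  n%:R * goebel k n = (n - 1)%:R * goebel k (n - 1) + goebel k (n - 1) ^+ k.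
Proof.
case: n => [//|[//|n]] _; rewrite subn1 -[RHS](@mulfK _ n.+2%:R) ?pnatr_eq0 //.
by rewrite [RHS]mulrAC mulrC.
Qed.

(* Computed in the extended reals; the infimum of the empty set is +oo. *)
Definition goebelN (R : realType) (k : nat) : \bar R :=
  ereal_inf [set n%:R%:E | n in
    [set n : nat | (1 <= n)%N /\ goebel k n \isn't a Num.int]].

Definition primorial (m : nat) : nat := (\prod_(1 <= p < m.+1 | prime p) p)%N.

(* Hence the truncated quotient m`! %/ primorial m is the exact one. *)
Lemma dvdn_primorial_fact (m : nat) : (primorial m %| m`!)%N.
Proof.
rewrite /primorial fact_prod big_mkcond /=.
by apply: (big_ind2 dvdn) => // [a b c d|p _]; [exact: dvdn_mul | case: ifP].
Qed.

(* Main.v *)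
Require Import Defs.
From mathcomp Require Import all_boot all_order all_algebra.
From mathcomp Require Import all_classical all_reals all_analysis.
From mathcomp Require Import cyclic zify.

(** Write [M := m!/m#] and [v := v_p(m!)] for a prime [p <= m]. If [m >= 4],
    then both [p - 1] and [p^(v-1)] divide [M], so [phi(p^v)] divides [k - 1] and
    [a^k = a] modulo [p^v] for every [a] prime to [p]. Since
    [g_n = g_(n-1) + (g_(n-1)^k - g_(n-1)) / n], a nonzero residue of [g_n]
    modulo [p] can change at a step only if [v_p(n) = v], that is, only if [n = p]
    and [m < 2p]; in that case no later [n <= m] is a multiple of [p], so the
    prime [p] causes no denominator afterwards. The residue starts at [2], and
    for [p = 2] it becomes odd at [n = 2]. For [m <= 3] the congruence on [k] is
    void, and [g_2] and [g_3] are integers for every [k]. *)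

Set Implicit Arguments.
Unset Strict Implicit.
Unset Printing Implicit Defensive.

Import Order.TTheory GRing.Theory Num.Theory.

Local Open Scope classical_set_scope.
Local Open Scope ring_scope.

(** * Valuations of the factorial and of its quotient by the primorial *)

Lemma primorial_gt0 (m : nat) : (0 < primorial m)%N.
Proof. by apply: prodn_cond_gt0 => p; exact: prime_gt0. Qed.

Lemma logn_primorial (q m : nat) :
  prime q -> logn q (primorial m) = (q <= m)%N.
Proof.
move=> pq; elim: m => [|m IH].
  by rewrite /primorial big_geq // logn1 leqNgt prime_gt0.
have -> : primorial m.+1 = (primorial m * (if prime m.+1 then m.+1 else 1))%N.
  by rewrite /primorial big_mkcond big_nat_recr //= -big_mkcond.
rewrite lognM ?primorial_gt0 //; last by case: ifP.
rewrite {}IH; case: ifP => [pm|npm].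
  by rewrite logn_prime //; case: eqP; lia.
rewrite logn1; case: (ltngtP q m.+1) => [||qm]; try lia.
by rewrite -qm pq in npm.
Qed.

Lemma fact_div_primorial_gt0 (m : nat) : (0 < m`! %/ primorial m)%N.
Proof.
by rewrite divn_gt0 ?primorial_gt0 // dvdn_leq ?fact_gt0 // dvdn_primorial_fact.
Qed.

Lemma logn_fact_div_primorial (q m : nat) : prime q -> (q <= m)%N ->
  logn q (m`! %/ primorial m) = (logn q m`!).-1.
Proof.
move=> pq qm; rewrite logn_div ?dvdn_primorial_fact //.
by rewrite logn_primorial // qm subn1.
Qed.

Lemma dvdn_mul_fact (d e m : nat) :
  (0 < d < e)%N -> (e <= m)%N -> (d * e %| m`!)%N.
Proof.
move=> de; elim: m => [|m IH]; first by lia.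
rewrite factS leq_eqVlt => /orP[/eqP em|em].
  by rewrite -em mulnC dvdn_mul // dvdn_fact //; lia.
by rewrite dvdn_mull // IH.
Qed.

(** If [n] and [q] differ, they are distinct factors of [m!], so [q * n] divides it. If [n = q], the
    factor [2 * q] takes the place of [n]. *)
Lemma logn_lt_logn_fact (q n m : nat) :
  prime q -> (0 < n <= m)%N -> (2 * q <= m)%N -> (logn q n < logn q m`!)%N.
Proof.
move=> pq nm qm; have q0 := prime_gt0 pq.
have key d : (0 < d)%N -> (q * d %| m`!)%N -> (logn q d < logn q m`!)%N.
  move=> d0 /dvdn_leq_log -/(_ q (fact_gt0 m)).
  by rewrite lognM // logn_prime // eqxx.
have [nq|nq|->] := ltngtP n q.
- by apply: key; [lia | rewrite mulnC; apply: dvdn_mul_fact; lia].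
- by apply: key; [lia | apply: dvdn_mul_fact; lia].
- apply: (@leq_ltn_trans (logn q (2 * q))).
    by rewrite dvdn_leq_log ?muln_gt0 ?dvdn_mull.
  by apply: key; [lia | apply: dvdn_mul_fact; lia].
Qed.

(* The bound [4 <= m] excludes [p = m = 3], where [p - 1 = 2] and [m!/m# = 1]. *)
Lemma dvdn_pred_prime_fact_div_primorial (p m : nat) :
  prime p -> (p <= m)%N -> (4 <= m)%N -> (p.-1 %| m`! %/ primorial m)%N.
Proof.
move=> pp pm m4; have p1 := prime_gt1 pp.
apply/dvdn_partP => [|q]; first by lia.
rewrite mem_primes => /and3P[pq _ qp].
have qle : (q <= p.-1)%N by apply: dvdn_leq => //; lia.
(* Write [p - 1 = c * q]. For odd [q], the cofactor [c] is not 1 by parity, so [2 * q <= p - 1]. *)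
have q2m : (2 * q <= m)%N.
  have /dvdnP[c pc] := qp.
  have [->|q2] := eqVneq q 2%N; first by [].
  have : c != 1%N.
    apply/eqP => c1; have q1 := prime_gt1 pq.
    have oq : odd q by apply: contraNT q2 => /(prime_oddPn pq) ->.
    have [/eqP|] := even_prime pp; lia.
  have := prime_gt0 pq; nia.
rewrite p_part pfactor_dvdn ?fact_div_primorial_gt0 //.
rewrite logn_fact_div_primorial //; last by lia.
by have := @logn_lt_logn_fact q p.-1 m pq; lia.
Qed.

Lemma totient_dvdn_fact_div_primorial (p m : nat) :
  prime p -> (p <= m)%N -> (4 <= m)%N ->
  (totient (p ^ logn p m`!) %| m`! %/ primorial m)%N.
Proof.
move=> pp pm m4; have p1 := prime_gt1 pp.
have v0 : (0 < logn p m`!)%N.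
  by rewrite logn_gt0 mem_primes pp fact_gt0 dvdn_fact //; lia.
rewrite totient_pfactor // Gauss_dvd.
  rewrite dvdn_pred_prime_fact_div_primorial //=.
  by rewrite pfactor_dvdn ?fact_div_primorial_gt0 // logn_fact_div_primorial.
by rewrite coprimeXr // coprimePn //; lia.
Qed.

(** * Euler's congruence for the exponent [k] *)

Lemma dvdn_exp_sub (p m k a : nat) :
  prime p -> (p <= m)%N -> (4 <= m)%N -> (1 <= k)%N ->
  (k = 1 %[mod m`! %/ primorial m])%N -> coprime a p ->
  (p ^ logn p m`! %| a ^ k - a)%N.
Proof.
move=> pp pm m4; case: k => // k _ /eqP.
rewrite eqn_mod_dvd // subn1 /= => Mk cap.
have /dvdnP[t ->] := dvdn_trans (totient_dvdn_fact_div_primorial pp pm m4) Mk.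
rewrite expnS -[X in (_ - X)%N]muln1 -mulnBr dvdn_mull //.
(* Subtraction is truncated, so [a = 0] has to be excluded: it is coprime to [p] only if [p = 1]. *)
rewrite -eqn_mod_dvd; last by rewrite expn_gt0; case: a cap => //;
  rewrite /coprime gcd0n => /eqP p1; rewrite p1 in pp.
rewrite mulnC expnM -modnXm Euler_exp_totient; last by rewrite coprimeXr.
by rewrite modnXm exp1n.
Qed.

(** * Integrality of the terms *)

Lemma goebel_succ_nat (k n a : nat) : (1 <= n)%N -> (2 <= k)%N -> (0 < a)%N ->
  goebel k n = a%:R -> (n.+1 %| a ^ k - a)%N ->
  goebel k n.+1 = (a + (a ^ k - a) %/ n.+1)%:R.
Proof.
move=> n1 k2 a0 ga dv /=; rewrite ga; case: eqP; first by lia.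
move=> _; apply: (canLR (mulfK _)); first by rewrite pnatr_eq0.
rewrite -natrX -!natrM -natrD; congr (_%:R).
rewrite mulnDl divnK // mulnS.
have : (a <= a ^ k)%N by rewrite -{1}[a]expn1 leq_pexp2l //; lia.
by rewrite mulnC; lia.
Qed.

Lemma dvdn2_exp_sub (k a : nat) : (0 < k)%N -> (2 %| a ^ k - a)%N.
Proof.
case: a => [|a] k0; first by rewrite exp0n.
rewrite dvdn2 oddB; last by rewrite -{1}[a.+1]expn1 leq_pexp2l.
by rewrite oddX; case: k k0 => // k _; rewrite orFb addbb.
Qed.

Lemma goebel2 (k : nat) : (2 <= k)%N -> goebel k 2 = (2 ^ k.-1).+1%:R.
Proof.
case: k => // k k2.
rewrite (@goebel_succ_nat _ _ 2) //; last by rewrite dvdn2_exp_sub.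
rewrite expnS -[X in (_ - X)%N]muln1 -mulnBr mulKn //=; congr (_%:R).
by have := expn_gt0 2 k; lia.
Qed.

Lemma expn2_mod3 (n : nat) : (2 ^ n = (odd n).+1 %[mod 3])%N.
Proof.
by elim: n => // n IH; rewrite expnS -modnMmr IH modnMmr /=; case: (odd n).
Qed.

Lemma goebel3_nat (k : nat) : (2 <= k)%N -> exists a : nat, goebel k 3 = a%:R.
Proof.
case: k => // k k2; have g2 := goebel2 k2; eexists.
apply: goebel_succ_nat g2 _ => //=; set a := (2 ^ k).+1.
have ak : (a = (odd k).+2 %[mod 3])%N.
  by rewrite /a -addn1 -modnDml expn2_mod3 modnDml addn1.
rewrite -eqn_mod_dvd; last by rewrite -{1}[a]expn1 leq_pexp2l.
(* The exponent is now [k.+1]. For odd [k], 3 divides [a]; for even [k], [a] is 2 modulo 3 and so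
   are its odd powers. *)
rewrite -modnXm ak modnXm; case: (boolP (odd k)) => [_|nk].
  by rewrite -modnXm exp0n.
by rewrite expn2_mod3 /= nk.
Qed.

(** Coprimality makes the induction work. It is kept only for primes above [n] or with [2 * p <= m],
    since the other primes divide no index from [n + 1] to [m]. The pair [p = 2], [n = 1] is left
    out because the first term is 2. *)
Lemma goebel_nat (m k : nat) : (4 <= m)%N -> (2 <= k)%N ->
  (k = 1 %[mod m`! %/ primorial m])%N ->
  forall n : nat, (1 <= n <= m)%N -> exists a : nat,
    [/\ goebel k n = a%:R, (0 < a)%N &
      forall p, prime p -> (p <= m)%N -> (n < p)%N || (2 * p <= m)%N ->
        ~~ ((p == 2) && (n == 1)) -> coprime a p]%N.
Proof.
move=> m4 k2 kM; elim=> // n IH nm.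
have [n0|n0] := posnP n.
  subst n; exists 2%N; split=> // p pp _ _.
  by rewrite eqxx andbT prime_coprime // dvdn_prime2 // eq_sym.
have {IH} [|a [ga a0 ca]] := IH; first by lia.
have dX p : prime p -> (p <= m)%N -> (n < p)%N || (2 * p <= m)%N ->
    ~~ ((p == 2) && (n == 1))%N -> (p ^ logn p m`! %| a ^ k - a)%N.
  by move=> pp pm c1 c2; apply: dvdn_exp_sub => //; [lia | exact: ca].
have nX : (n.+1 %| a ^ k - a)%N.
  apply/dvdn_partP => // p; rewrite mem_primes => /and3P[pp _ pn].
  have pn1 := dvdn_leq (ltn0Sn n) pn.
  rewrite p_part; case: (boolP ((p == 2) && (n == 1))%N) => [|c2].
    by case/andP=> /eqP -> /eqP ->; apply: dvdn2_exp_sub; lia.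
  apply: dvdn_trans (dX p pp _ _ c2); last 2 first.
  - by lia.
  (* Either [n + 1 = p], so [n < p], or [n + 1] is at least [2 * p]. *)
  - have /dvdnP[[|[|c]] pc] := pn; [by []| by apply/orP; left; lia |].
    by apply/orP; right; have := prime_gt0 pp; nia.
  rewrite dvdn_exp2l // dvdn_leq_log ?fact_gt0 //.
  by rewrite dvdn_fact //; lia.
exists (a + (a ^ k - a) %/ n.+1)%N; split.
- exact: goebel_succ_nat.
- by rewrite addn_gt0 a0.
move=> p pp pm c1 c2.
case: (boolP ((p == 2) && (n == 1))%N) => [|c3].
  (* The second term, a positive power of 2 plus 1, is odd. *)
  case/andP=> /eqP p2 /eqP n1; move: ga; rewrite {}p2 {}n1 => /eqP.
  rewrite /= eqr_nat => /eqP <-.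
  case: k k2 {kM nX dX} => // k k2.
  rewrite expnS -[X in (_ - X)%N]muln1 -mulnBr mulKn // coprimen2.
  have -> : (2 + (2 ^ k - 1) = (2 ^ k).+1)%N by have := expn_gt0 2 k; lia.
  by rewrite /= oddX; case: k k2.
have c4 : (n < p)%N || (2 * p <= m)%N.
  by case/orP: c1 => [/ltnW ->|->]; rewrite ?orbT.
set d := ((a ^ k - a) %/ n.+1)%N.
(* The valuation of [a ^ k - a] at [p] is at least that of [m!], which exceeds that of [n + 1]; a
   factor [p] survives the division. *)
have pd : (p %| d)%N.
  have [->//|d0] := posnP d.
  have := dX p pp pm c4 c3.
  rewrite -(divnK nX) -/d pfactor_dvdn ?muln_gt0 ?d0 // lognM //.
  have : (logn p n.+1 < logn p m`!)%N.
    case/orP: c1 => [np|p2m]; last exact: logn_lt_logn_fact.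
    rewrite [X in (X < _)%N]lognE pp /= gtnNdvd // logn_gt0 mem_primes pp.
    by rewrite fact_gt0 dvdn_fact // prime_gt0.
  move=> /leq_trans lt /lt; rewrite -[X in (X < _)%N]add0n ltn_add2r.
  by rewrite logn_gt0 mem_primes => /and3P[].
rewrite coprime_sym prime_coprime // dvdn_addl // -prime_coprime //.
by rewrite coprime_sym ca.
Qed.

Lemma goebel_int (m k n : nat) : (2 <= k)%N ->
  (k = 1 %[mod m`! %/ primorial m])%N -> (1 <= n <= m)%N ->
  goebel k n \is a Num.int.
Proof.
move=> k2 kM nm; suff [a ->] : exists a : nat, goebel k n = a%:R by [].
have [m4|m4] := leqP 4 m.
  by have [a [ga _ _]] := goebel_nat m4 k2 kM nm; exists a.
case: n nm => [|[|[|[|n]]]] nm; [by []| by exists 2%N | | |by lia].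
  by exists (2 ^ k.-1).+1; rewrite goebel2.
exact: goebel3_nat.
Qed.

(** * Bounds on the first non-integral index *)

Lemma goebelN_gt (R : realType) (m k : nat) : (2 <= k)%N ->
  (k = 1 %[mod m`! %/ primorial m])%N -> (m%:R%:E < goebelN R k)%E.
Proof.
(* Passing to an infimum keeps only weak inequalities, so the lower bound used is [m + 1]. *)
move=> k2 kM; apply: (@lt_le_trans _ _ m.+1%:R%:E).
  by rewrite lte_fin ltr_nat.
apply: le_ereal_inf_tmp => _ [n [n1 nint] <-].
rewrite lee_fin ler_nat ltnNge; apply: contra nint => nm.
by apply: goebel_int kM _ => //; rewrite n1.
Qed.

Theorem mainTheorem1 (R : realType) :
  (forall m : nat, (1 <= m)%N ->
    forall k : nat, (2 <= k)%N ->
      (k = 1 %[mod m`! %/ primorial m])%N ->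
      (m%:R%:E < goebelN R k)%E)
  /\ ereal_sup [set goebelN R k | k in [set k : nat | (2 <= k)%N]] = +oo%E.
Proof.
split=> [m _ k|]; first exact: goebelN_gt.
apply: eq_infty => r.
(* An [m] above [|r|] suffices, with the exponent one more than the modulus; positivity of the
   modulus gives [k >= 2]. *)
pose m := Num.bound `|r|; pose k := (m`! %/ primorial m).+1.
have k2 : (2 <= k)%N by rewrite ltnS fact_div_primorial_gt0.
have kM : (k = 1 %[mod m`! %/ primorial m])%N by rewrite /k -addn1 modnDl.
apply: (@le_trans _ _ m%:R%:E).
  by rewrite lee_fin (le_trans (ler_norm r)) // ltW // archi_boundP ?normr_ge0.
apply: le_trans (ltW (goebelN_gt R k2 kM)) _.
by apply: ereal_sup_ubound; exists k.
Qed.
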